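(* Let $k\ge 1$ be an integer and let $G$ be a $4k$-connected convex bipartite graph. Then a CDS partition of $G$ of size $k$ exists, and it can be computed in polynomial time.
   Context: All graphs are finite, undirected and simple. A graph is $t$-connected if it has more than $t$ vertices and the removal of any vertex set of size at most $t-1$ does not disconnect it. A bipartite graph $G=(A\cup B,E)$ (with parts $A$, $B$) is called convex bipartite if there exists a linear ordering $\sigma$ of $A$ such that for every $v\in B$ the neighbourhood $N(v)\subseteq A$ is consecutive under $\sigma$. A connected dominating set (CDS) of $G$ is a nonempty set $S\subseteq V(G)$ such that $G[S]$ is connected and every vertex of $V(G)\setminus S$ is adjacent to some vertex of $S$. A CDS partition of $G$ of size $k$ is a partition of $V(G)$ into $k$ pairwise disjoint sets, each of which is a connected dominating set of $G$. *)

(* Defs.v *)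
From mathcomp Require Import all_boot.

Set Implicit Arguments.
Unset Strict Implicit.
Unset Printing Implicit Defensive.

Section Graphs.
Variables (T : finType) (e : rel T).

Definition simple_graph : Prop := symmetric e /\ irreflexive e.

(* The subgraph induced on S; vacuously connected when S is empty. *)
Definition connected_on (S : {set T}) : Prop :=
  {in S &, forall x y,
     connect [rel u v | [&& u \in S, v \in S & e u v]] x y}.

Definition t_connected (t : nat) : Prop :=
  t < #|T| /\ forall S : {set T}, #|S| < t -> connected_on (~: S).

Definition bipartition (A B : {set T}) : Prop :=
  [/\ A :|: B = [set: T], [disjoint A & B] &
      forall x y, e x y -> (x \in A) && (y \in B) || (x \in B) && (y \in A)].

(* A linear ordering of A is a duplicate-free list of the elements of A. *)
Definition convex_bipartite : Prop :=
  exists (A B : {set T}) (sigma : seq T),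
    [/\ bipartition A B, uniq sigma, sigma =i A &
        forall v, v \in B ->
          {in A & &, forall x y z,
             index x sigma <= index y sigma <= index z sigma ->
             e v x -> e v z -> e v y}].

Definition cds (S : {set T}) : Prop :=
  [/\ S != set0, connected_on S &
      forall v, v \notin S -> exists2 u, u \in S & e v u].

Definition cds_partition (k : nat) (P : {set {set T}}) : Prop :=
  [/\ partition P [set: T], #|P| = k & forall S, S \in P -> cds S].

End Graphs.

(* Polynomial time is measured on the WHILE language over binary trees of
   N. D. Jones, "Computability and Complexity from a Programming Perspective",
   where every primitive operation has unit cost. A value obtained in t steps
   is stored as a shared (DAG) structure with at most t cells besides those of
   the input, so a Turing machine simulates the language with polynomial
   overhead, and conversely. *)

Inductive tree : Type := Leaf | Node (l r : tree).

Fixpoint tree_size (a : tree) : nat :=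
  if a is Node l r then (tree_size l + tree_size r).+1 else 1.

Definition left_of (a : tree) : tree := if a is Node l _ then l else Leaf.
Definition right_of (a : tree) : tree := if a is Node _ r then r else Leaf.

Inductive expr : Type :=
| EVar (x : nat)
| ELeaf
| ENode (e1 e2 : expr)
| ELeft (e1 : expr)
| ERight (e1 : expr).

Inductive cmd : Type :=
| CSkip
| CAssign (x : nat) (a : expr)
| CSeq (c1 c2 : cmd)
| CIf (a : expr) (c1 c2 : cmd)
| CWhile (a : expr) (c1 : cmd).

Definition store : Type := nat -> tree.

Definition update (s : store) (x : nat) (v : tree) : store :=
  fun y => if y == x then v else s y.

Fixpoint eval (s : store) (a : expr) : tree :=
  match a with
  | EVar x => s x
  | ELeaf => Leaf
  | ENode a1 a2 => Node (eval s a1) (eval s a2)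
  | ELeft a1 => left_of (eval s a1)
  | ERight a1 => right_of (eval s a1)
  end.

Fixpoint eval_cost (a : expr) : nat :=
  match a with
  | EVar _ | ELeaf => 1
  | ENode a1 a2 => (eval_cost a1 + eval_cost a2).+1
  | ELeft a1 | ERight a1 => (eval_cost a1).+1
  end.

(* exec s c s' t: from store s, command c halts in store s' after t steps.
   In tests, Leaf is false and every Node is true. *)
Inductive exec : store -> cmd -> store -> nat -> Prop :=
| exec_skip s : exec s CSkip s 1
| exec_assign s x a :
    exec s (CAssign x a) (update s x (eval s a)) (eval_cost a).+1
| exec_seq s1 s2 s3 c1 c2 t1 t2 :
    exec s1 c1 s2 t1 -> exec s2 c2 s3 t2 ->
    exec s1 (CSeq c1 c2) s3 (t1 + t2).+1
| exec_if_true s s' a c1 c2 t :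
    eval s a <> Leaf -> exec s c1 s' t ->
    exec s (CIf a c1 c2) s' (eval_cost a + t).+1
| exec_if_false s s' a c1 c2 t :
    eval s a = Leaf -> exec s c2 s' t ->
    exec s (CIf a c1 c2) s' (eval_cost a + t).+1
| exec_while_true s1 s2 s3 a c t1 t2 :
    eval s1 a <> Leaf -> exec s1 c s2 t1 -> exec s2 (CWhile a c) s3 t2 ->
    exec s1 (CWhile a c) s3 (eval_cost a + t1 + t2).+1
| exec_while_false s a c :
    eval s a = Leaf -> exec s (CWhile a c) s (eval_cost a).+1.

(* Input and output are both passed in variable 0. *)
Definition runs (p : cmd) (input output : tree) (t : nat) : Prop :=
  exists2 s : store,
    exec (update (fun=> Leaf) 0 input) p s t & s 0 = output.

Definition enc_bool (b : bool) : tree := if b then Node Leaf Leaf else Leaf.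

Definition enc_seq (X : Type) (f : X -> tree) (s : seq X) : tree :=
  foldr (fun x => Node (f x)) Leaf s.

Definition enc_nat (n : nat) : tree := iter n (Node Leaf) Leaf.

(* Characteristic vector, in the order of enum T. *)
Definition enc_set (T : finType) (S : {set T}) : tree :=
  enc_seq (fun x => enc_bool (x \in S)) (enum T).

(* The number k, in unary, and the adjacency matrix. *)
Definition enc_instance (T : finType) (e : rel T) (k : nat) : tree :=
  Node (enc_nat k)
       (enc_seq (fun x => enc_seq (fun y => enc_bool (e x y)) (enum T))
                (enum T)).

(* Main.v *)
Require Import Defs.
From mathcomp Require Import all_boot.
From mathcomp Require Import zify.

(* A superset of a connected dominating set (CDS) is a CDS, so dropping vertices
   one at a time as long as a CDS remains yields an inclusion-minimal one in a
   single pass. The k parts are found greedily: k-1 times, remove a minimal CDS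
   from what is left; what is left in the end is the last part. The ordering of
   A is used only in the correctness proof.

   Let t = 4k and let S be a minimal CDS. A vertex of A in S has at most two
   neighbours in S, and t consecutive vertices of A contain at most three
   vertices of S. It follows that S meets in at most four vertices the set X
   formed by the vertices strictly between a and a' in A and by the common
   neighbours of a and a' (when these are close). For a before a', X separates
   a from a', hence has at least 4k elements, and k-1 minimal CDSs cannot cover
   it; so consecutive remaining vertices of A keep a common neighbour. The same
   count shows that what is left is dominating.

   The programs use only loops over k-1 or over the rows of the adjacency matrix
   of the unmodified input, so polynomial time follows from their syntax. A set S
   is a CDS iff the closure of one of its vertices under adding the neighbours
   of the members lying in S is the whole vertex set. *)

Set Implicit Arguments.
Unset Strict Implicit.
Unset Printing Implicit Defensive.

(** * Connected sets and redundant vertices *)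

Section Connectivity.
Variables (T : finType) (e : rel T).

Definition induced (S : {set T}) : rel T :=
  [rel u v | [&& u \in S, v \in S & e u v]].

Lemma connected_on_closed (S K : {set T}) x :
    connected_on e S -> x \in S -> x \in K ->
    {in S &, forall u v, u \in K -> e u v -> v \in K} ->
  S \subset K.
Proof.
move=> conS xS xK clK; apply/subsetP => y yS.
have [p pth ->] := connectP (conS x y xS yS).
elim: p x xS xK pth => //= z p IHp x xS xK /andP[/and3P[_ zS exz] pth].
exact: (IHp z zS (clK x z xS zS xK exz) pth).
Qed.

Hypothesis e_sym : symmetric e.

Lemma induced_connect_sym S : connect_sym (induced S).
Proof.
by apply: sym_connect_sym => x y; rewrite /induced /= e_sym andbCA.
Qed.

Lemma connected_on_hub (S : {set T}) c :
  {in S, forall x, connect (induced S) x c} -> connected_on e S.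
Proof.
move=> hub x y xS yS; apply: (connect_trans (hub x xS)).
by rewrite induced_connect_sym hub.
Qed.

(** Walks through [v] can be rerouted via [c]: together with [v], the vertices joined to [c] inside
    [S :\ v] are closed under adjacency in [S]. *)
Lemma connected_on_setD1 (S : {set T}) v c :
    connected_on e S -> v \in S -> c \in S :\ v ->
    {in S :\ v, forall y, e v y -> connect (induced (S :\ v)) y c} ->
  connected_on e (S :\ v).
Proof.
move=> conS vS cSv hub.
pose K := [set y | connect (induced (S :\ v)) y c].
suffices sub : S \subset v |: K.
  apply: (@connected_on_hub _ c) => x /setD1P[xv xS].
  by have := subsetP sub x xS; rewrite in_setU1 (negPf xv) inE.
have cS : c \in S by case/setD1P: cSv.
apply: (connected_on_closed conS cS); first by rewrite in_setU1 inE connect0 orbT.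
move=> u w uS wS; rewrite !inE => uK euw.
case: (eqVneq w v) => //= wv.
have [uv|uv] := eqVneq u v.
  by apply: hub; rewrite ?inE ?wv // -uv.
move: uK; rewrite (negPf uv) /=; apply: connect_trans.
by apply: connect1; rewrite /induced /= !inE wv uv uS wS e_sym.
Qed.

Lemma cds_superset (S S' : {set T}) : cds e S -> S \subset S' -> cds e S'.
Proof.
move=> [S0 conS domS] sub.
have [c cS] := set0Pn _ S0.
split.
- by apply/set0Pn; exists c; apply: (subsetP sub).
- have lift x : x \in S -> connect (induced S') x c.
    move=> xS; apply: connect_sub (conS x c xS cS) => u w /and3P[uS wS euw].
    by apply: connect1; rewrite /induced /= euw !(subsetP sub).
  apply: (@connected_on_hub _ c) => x xS'.
  have [/lift//|/domS[u uS exu]] := boolP (x \in S).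
  apply: connect_trans (lift u uS); apply: connect1.
  by rewrite /induced /= xS' exu (subsetP sub).
- move=> v vS'; have [|u uS evu] := domS v.
    by apply: contra vS'; apply: (subsetP sub).
  by exists u => //; apply: (subsetP sub).
Qed.

Definition minimal_cds (S : {set T}) : Prop :=
  cds e S /\ {in S, forall v, ~ cds e (S :\ v)}.

(** The redundancy test behind all bounds on minimal CDSs: under the remaining hypotheses [S :\ v]
    would still be a CDS. *)
Lemma minimal_cds_hub (S : {set T}) v c :
    minimal_cds S -> v \in S -> c \in S :\ v ->
    {in S :\ v, forall y, e v y -> connect (induced (S :\ v)) y c} ->
    (exists2 u, u \in S :\ v & e v u) ->
    (forall y, y \notin S -> e y v -> exists2 u, u \in S :\ v & e y u) ->
  False.
Proof.
move=> [[_ conS domS] minS] vS cSv hub vdom ydom; apply: (minS v vS); split.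
- by apply/set0Pn; exists c.
- exact: connected_on_setD1 hub.
- move=> y; rewrite !inE negb_and negbK => /orP[/eqP->//|yS].
  have [u uS eyu] := domS y yS.
  have [uv|uv] := eqVneq u v; first by apply: ydom => //; rewrite -uv.
  by exists u => //; rewrite !inE uv.
Qed.

Hypothesis e_irr : irreflexive e.

(** Deleting a smaller neighbourhood would isolate [v] from some other vertex, which exists because
    there are more than [t] vertices. *)
Lemma t_connected_degree t v : t_connected e t -> t <= #|[set u | e v u]|.
Proof.
move=> [tT conn]; rewrite leqNgt; apply/negP => small.
have [w wP] : exists w, w \notin v |: [set u | e v u].
  apply/existsP; rewrite -negb_forall; apply/negP => /forallP full.
  have : [set: T] \subset v |: [set u | e v u] by apply/subsetP => w _; exact: full.
  move/subset_leq_card; rewrite cardsT cardsU1 leqNgt => /negP; apply.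
  by apply: leq_trans tT; rewrite ltnS -add1n in small *;
    apply: leq_trans small; rewrite leq_add2r leq_b1.
move: wP; rewrite !inE negb_or => /andP[wv evw].
have vC : v \in ~: [set u | e v u] by rewrite !inE e_irr.
have := connected_on_closed (conn _ small) vC (set11 v).
move=> /(_ _)/subsetP/(_ w); rewrite !inE => sub.
case/negP: wv; apply: sub => //.
by move=> u x _ xC /set1P ux eux; move: xC; rewrite !inE -ux eux.
Qed.

End Connectivity.

(** * Minimal connected dominating sets of convex bipartite graphs *)

Section Convex.
Variables (T : finType) (e : rel T) (A B : {set T}) (sigma : seq T) (t : nat).
Hypothesis e_sym : symmetric e.
Hypothesis e_irr : irreflexive e.
Hypothesis AB_bip : bipartition e A B.
Hypothesis sigma_uniq : uniq sigma.
Hypothesis sigma_A : sigma =i A.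
Hypothesis sigma_convex : forall v, v \in B ->
  {in A & &, forall x y z,
     index x sigma <= index y sigma <= index z sigma ->
     e v x -> e v z -> e v y}.
Hypothesis t_conn : t_connected e t.
Hypothesis t_gt1 : 1 < t.

Local Notation pos x := (index x sigma).

Lemma partB x : (x \in B) = (x \notin A).
Proof.
have [/setP/(_ x) full dis _] := AB_bip; move: full; rewrite !inE.
by have [xA _|] := boolP (x \in A); first rewrite (disjointFr dis).
Qed.

Lemma edge_parts x y : e x y -> (y \in A) = (x \notin A).
Proof.
have [_ _ bip] := AB_bip; move=> /bip; rewrite !partB.
by case: (x \in A); case: (y \in A).
Qed.

Lemma edge_AB x y : x \in A -> e x y -> y \in B.
Proof. by move=> xA /edge_parts; rewrite partB xA => ->. Qed.

Lemma edge_BA x y : x \in B -> e x y -> y \in A.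
Proof. by rewrite partB => xA /edge_parts ->. Qed.

Lemma pos_inj : {in A &, injective (fun x => pos x)}.
Proof.
move=> x y xA yA eq_pos.
by rewrite -[x](nth_index x (s := sigma)) ?sigma_A // eq_pos nth_index ?sigma_A.
Qed.

Lemma convex_edge v x y z :
  v \in B -> y \in A -> e v x -> e v z -> pos x <= pos y <= pos z -> e v y.
Proof.
by move=> vB yA vx vz xyz; apply: (sigma_convex vB _ yA _ xyz) => //; apply: edge_BA vB _.
Qed.

Lemma card_pos_interval (Y : {set T}) lo hi :
    Y \subset A -> {in Y, forall y, lo <= pos y < hi} ->
  #|Y| <= hi - lo.
Proof.
move=> YA Ypos; rewrite -(size_iota lo (hi - lo)) cardE.
rewrite -(size_map (fun x => pos x)); apply: uniq_leq_size.
  rewrite map_inj_in_uniq ?enum_uniq // => x y; rewrite !mem_enum => xY yY.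
  by apply: pos_inj; apply: (subsetP YA).
by move=> _ /mapP[y yY ->]; rewrite mem_enum in yY; have := Ypos y yY; rewrite mem_iota; lia.
Qed.

Lemma increasing_elements (Y : {set T}) n :
    Y \subset A -> n <= #|Y| ->
  exists s, [/\ size s = n, {subset s <= Y} & sorted (fun x y => pos x < pos y) s].
Proof.
move=> YA nY; exists (take n [seq x <- sigma | x \in Y]); split.
- apply: size_takel; apply: leq_trans nY _; rewrite cardE uniq_leq_size ?enum_uniq //.
  move=> x; rewrite mem_enum mem_filter => xY.
  by rewrite xY sigma_A (subsetP YA).
- by move=> x /mem_take; rewrite mem_filter => /andP[].
- apply: take_sorted; apply: sorted_filter; first by move=> y x z; apply: ltn_trans.
  case def_s: {3}sigma => [//|x0 s0]; rewrite -def_s; apply/(sortedP x0) => i ltis.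
  by rewrite !index_uniq // ltnW.
Qed.

Lemma degree v : t <= #|[set u | e v u]|.
Proof. exact: t_connected_degree. Qed.

(** The [t - 1] positions from [lo] on cannot hold all neighbours of [b]; the second alternative
    says [pos x >= lo + t - 1]. *)
Lemma neighbour_outside b lo :
  b \in B -> exists2 x, e b x & (pos x < lo) || (lo + t <= (pos x).+1).
Proof.
move=> bB; apply/exists_inP; apply: contraT; rewrite negb_exists_in => /forall_inP out.
have : t <= lo + t.-1 - lo.
  apply: leq_trans (degree b) _; apply: card_pos_interval.
    by apply/subsetP => x; rewrite inE; apply: edge_BA.
  by move=> x; rewrite inE => /out; lia.
lia.
Qed.

Lemma no_triangle x y z : e x y -> e y z -> e z x -> False.
Proof.
by move=> /edge_parts xy /edge_parts yz /edge_parts; rewrite yz xy; case: (x \in A).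
Qed.

(** Otherwise connectivity makes [S] the singleton of [v]; a second neighbour of a neighbour of [v]
    would then be adjacent to [v], closing a triangle. *)
Lemma cds_inner_neighbour (S : {set T}) v :
  cds e S -> v \in S -> exists2 u, u \in S & e v u.
Proof.
move=> [_ conS domS] vS.
apply/exists_inP; apply: contraT; rewrite negb_exists_in => /forall_inP iso.
have /subsetP sub : S \subset [set v].
  apply: (connected_on_closed conS vS (set11 v)) => u w uS wS /set1P-> /=.
  by rewrite (negPf (iso w wS)).
have [w] : exists w, w \in [set u | e v u].
  by apply/card_gt0P; apply: leq_trans (degree v); apply: ltnW.
rewrite inE => evw.
have [w' /setD1P[w'v]] : exists w', w' \in [set u | e w u] :\ v.
  apply/card_gt0P; have := degree w; rewrite (cardsD1 v) inE e_sym evw; lia.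
rewrite inE => eww'.
have [|u /sub/set1P-> ew'v] := domS w'; first by apply: contra w'v => /sub/set1P->.
by case: (no_triangle evw eww' ew'v).
Qed.

(* The two members of [S] that reach furthest to the left and to the right
   make every other neighbour of [c] in [S] redundant. *)
Lemma minimal_cds_degree (S : {set T}) c :
  minimal_cds e S -> c \in S -> c \in A -> #|[set d in S | e c d]| <= 2.
Proof.
move=> minS cS cA; rewrite leqNgt; apply/negP => gt2.
set X := [set d in S | e c d] in gt2.
have [d0 d0X] : exists d, d \in X by apply/card_gt0P; apply: ltn_trans gt2.
have XP d : d \in X -> [/\ d \in S, e c d, e d c & d \in B].
  by rewrite inE => /andP[dS cd]; split; rewrite // 1?e_sym //; apply: edge_AB cd.
pose ok (p : T * T) := (p.1 \in X) && e p.1 p.2.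
have ok0 : ok (d0, c) by rewrite /ok d0X; have [] := XP _ d0X.
have [[dL xL]] := @arg_minnP _ (d0, c) ok (fun p => pos p.2) ok0.
have [[dR xR]] := @arg_maxnP _ (d0, c) ok (fun p => pos p.2) ok0.
rewrite /ok /= => /andP[dRX eR] maxR /andP[dLX eL] minL.
have [d] : exists d, d \in X :\: [set dL; dR].
  apply/card_gt0P; have := cardsID [set dL; dR] X.
  have : #|X :&: [set dL; dR]| <= 2.
    by apply: leq_trans (subset_leq_card (subsetIr _ _)) _; rewrite cards2; case: eqP.
  by move: gt2; clear; lia.
rewrite !inE negb_or -andbA => /and4P[ddL ddR dS ecd].
have dX : d \in X by rewrite inE dS.
have [_ _ edc dB] := XP d dX.
have [dLS _ eLc dLB] := XP dL dLX; have [dRS _ eRc dRB] := XP dR dRX.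
have neq u : u \in A -> u != d by apply: contraTneq => ->; rewrite -partB.
have cover y : e d y -> e y dL || e y dR.
  move=> edy; rewrite ![e y _]e_sym; have yA := edge_BA dB edy.
  have le_y : pos xL <= pos y <= pos xR.
    by have := minL (d, y); have := maxR (d, y); rewrite /= dX edy => /(_ isT)-> /(_ isT)->.
  have [le_Ly le_yR] := andP le_y.
  apply/orP; case: (leqP (pos y) (pos c)) => [yc|/ltnW yc]; [left|right].
    by apply: (convex_edge dLB yA eL eLc); rewrite le_Ly.
  by apply: (convex_edge dRB yA eRc eR); rewrite yc.
have cSd : c \in S :\ d by rewrite !inE neq.
have dLSd : dL \in S :\ d by rewrite !inE eq_sym ddL.
have dRSd : dR \in S :\ d by rewrite !inE eq_sym ddR.
apply: (minimal_cds_hub e_sym minS dS cSd).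
- move=> y ySd /cover/orP[] eyd; [apply: (@connect_trans _ _ dL)|apply: (@connect_trans _ _ dR)];
    by apply: connect1; rewrite /induced /= ?ySd ?cSd ?dLSd ?dRSd.
- by exists c.
- move=> y yS; rewrite e_sym => /cover/orP[] eyd; [by exists dL|by exists dR].
Qed.

Section Triple.
Variables (S : {set T}) (c1 c2 c3 : T).
Hypothesis minS : minimal_cds e S.
Hypotheses (c1S : c1 \in S) (c2S : c2 \in S) (c3S : c3 \in S).
Hypotheses (c1A : c1 \in A) (c2A : c2 \in A) (c3A : c3 \in A).
Hypotheses (lt12 : pos c1 < pos c2) (lt23 : pos c2 < pos c3).
Hypothesis close : pos c3 <= pos c1 + t.

(** The neighbourhood of [b] does not fit into the [t - 1] positions after [c1], so it extends to
    [c1] or further left or, by [close], to [c3] or further right; convexity does the rest. *)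
Lemma triple_cover b : b \in B -> e b c2 -> e b c1 || e b c3.
Proof.
move=> bB eb2; have [x ebx out] := neighbour_outside (pos c1).+1 bB.
case: (leqP (pos x) (pos c1)) => xc1; apply/orP; [left|right].
  by apply: (convex_edge bB c1A ebx eb2); rewrite xc1 ltnW.
apply: (convex_edge bB c3A eb2 ebx); rewrite ltnW //=.
by move: close out xc1; clear; lia.
Qed.

(** [c1] and [c3] take over what [c2] dominates, so [c2] can only be needed for connectivity. *)
Lemma triple_no_hub h : h \in S :\ c2 ->
  ~ {in S, forall d, e c2 d -> connect (induced e (S :\ c2)) d h}.
Proof.
move=> hS hub.
have neq u v : pos u < pos v -> u != v by apply: contraTneq => ->; rewrite ltnn.
apply: (minimal_cds_hub e_sym minS c2S hS).
- by move=> y /setD1P[_ yS]; apply: hub.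
- have [u uS eu] := cds_inner_neighbour minS.1 c2S.
  exists u => //; rewrite !inE uS andbT; apply: contraTneq eu => ->.
  by rewrite e_irr.
- move=> y _ ey2; have yB : y \in B by apply: (edge_AB c2A); rewrite e_sym.
  have /orP[ey|ey] := triple_cover yB ey2; [exists c1|exists c3] => //.
    by rewrite !inE neq.
  by rewrite !inE eq_sym neq.
Qed.

(** Otherwise [d] would be a hub: every neighbour of [c2] in [S] is adjacent to [c1] or [c3], and
    through it joined to [d]. *)
Lemma triple_not_spanned d : d \in S -> e d c1 -> ~~ e d c3.
Proof.
move=> dS ed1; apply/negP => ed3.
have neq u v : pos u < pos v -> u != v by apply: contraTneq => ->; rewrite ltnn.
have neqd u : u \in S -> e u c2 -> u \in S :\ c2.
  move=> uS eu; rewrite !inE uS andbT; apply: contraTneq eu => ->.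
  by rewrite e_irr.
have dB : d \in B by apply: (edge_AB c1A); rewrite e_sym.
have ed2 : e d c2 by apply: (convex_edge dB c2A ed1 ed3); rewrite !(ltnW lt12, ltnW lt23).
apply: (@triple_no_hub d); first exact: neqd.
move=> d' d'S; rewrite e_sym => ed'.
have d'B : d' \in B by apply: (edge_AB c2A); rewrite e_sym.
have [c [cS2 ed'c edc]] : exists c, [/\ c \in S :\ c2, e d' c & e d c].
  have /orP[ey|ey] := triple_cover d'B ed'; [exists c1|exists c3]; split=> //.
    by rewrite !inE neq.
  by rewrite !inE eq_sym neq.
by apply: (@connect_trans _ _ c); apply: connect1; rewrite /induced /= cS2 neqd //= e_sym.
Qed.

(* Otherwise [c1] could take over the role of [c2]. *)
Lemma triple_right : exists d, [/\ d \in S, e d c2 & ~~ e d c1].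
Proof.
have [ex|nex] := boolP [exists d in S, e d c2 && ~~ e d c1].
  by have /exists_inP[d dS /andP[]] := ex; exists d.
have c1S2 : c1 \in S :\ c2 by rewrite !inE c1S andbT; apply: contraTneq lt12 => ->; rewrite ltnn.
case: (@triple_no_hub c1) => // d dS; rewrite e_sym => ed2.
move/exists_inPn/(_ d dS): nex; rewrite ed2 negbK => ed1.
apply: connect1; rewrite /induced /= c1S2 !inE dS ed1 !andbT.
by apply: contraTneq ed2 => ->; rewrite e_irr.
Qed.

End Triple.

(* A neighbour of [c2] in [S] that misses [c1] has degree at least [t], so it
   reaches beyond [c4]; then it spans the triple [c2], [c3], [c4]. *)
Lemma minimal_cds_window (S : {set T}) i :
  minimal_cds e S -> #|[set y in A | i <= pos y < i + t] :&: S| <= 3.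
Proof.
move=> minS; rewrite leqNgt; apply/negP => gt3.
have [|s [sz sub srt]] := increasing_elements _ gt3.
  by apply/subsetP => x; rewrite !inE -andbA => /andP[].
case: s sz sub srt => [|c1 [|c2 [|c3 [|c4 [|]]]]] //= _ sub /and4P[lt12 lt23 lt34 _].
have cP c : c \in [:: c1; c2; c3; c4] -> [/\ c \in S, c \in A & i <= pos c < i + t].
  by move/sub; rewrite !inE => /andP[/andP[]].
have [|c1S c1A p1] := cP c1; rewrite ?inE ?eqxx ?orbT //.
have [|c2S c2A p2] := cP c2; rewrite ?inE ?eqxx ?orbT //.
have [|c3S c3A p3] := cP c3; rewrite ?inE ?eqxx ?orbT //.
have [|c4S c4A p4] := cP c4; rewrite ?inE ?eqxx ?orbT //.
have [|d [dS ed2 ed1]] := triple_right minS c1S c2S c3S c1A c2A c3A lt12 lt23.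
  by move: p1 p3; clear; lia.
have dB : d \in B by apply: (edge_AB c2A); rewrite e_sym.
have [x edx out] := neighbour_outside (pos c1).+1 dB.
have ltx : pos c4 <= pos x.
  case/orP: out => out; last by move: p1 p4 out; clear; lia.
  by case/negP: ed1; apply: (convex_edge dB c1A edx ed2); rewrite -ltnS out ltnW.
have ed4 : e d c4.
  by apply: (convex_edge dB c4A ed2 edx); rewrite ltx andbT ltnW // (ltn_trans lt23).
have := triple_not_spanned minS c2S c3S c4S c2A c3A c4A lt23 lt34 _ dS ed2.
by rewrite ed4 => /(_ _)/negP[]//; move: p2 p4; clear; lia.
Qed.

Definition between a a' := [set y in A | pos a < pos y < pos a'].
Definition common a a' := [set b | e a b && e a' b].

(** A common neighbour in [S] has a neighbour in [S] of its own, at or before [a] or at or after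
    [a']. By convexity it is then adjacent to the last member of [S] in [A] up to [a], or to the
    first from [a'] on, and each of these has at most two neighbours in [S]. The case [a = a']
    serves domination. *)
Lemma minimal_cds_common (S : {set T}) a a' :
    minimal_cds e S -> a \in A -> a' \in A -> pos a <= pos a' ->
    between a a' :&: S = set0 ->
  #|common a a' :&: S| <= 4.
Proof.
move=> minS aA a'A le_aa' empty.
pose Yl := [set d in common a a' :&: S | [exists c in S, e d c && (pos c <= pos a)]].
pose Yr := [set d in common a a' :&: S | [exists c in S, e d c && (pos a' <= pos c)]].
have comP d : d \in common a a' -> [/\ d \in B, e d a & e d a'].
  by rewrite inE => /andP[ead ea'd]; rewrite ![e d _]e_sym; split=> //; apply: edge_AB ead.
have Yl2 : #|Yl| <= 2.
  have [->|[d0]] := set_0Vmem Yl; first by rewrite cards0.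
  rewrite inE => /andP[/setIP[com0 _] /exists_inP[c0 c0S /andP[e0 le0]]].
  pose ok c := [&& c \in S, c \in A & pos c <= pos a].
  have okc0 : ok c0 by rewrite /ok c0S le0 (edge_BA _ e0) //; have [] := comP d0 com0.
  have [c1 /and3P[c1S c1A le1] max1] := @arg_maxnP _ c0 ok (fun c => pos c) okc0.
  apply: leq_trans (minimal_cds_degree minS c1S c1A); apply: subset_leq_card.
  apply/subsetP => d /setIdP[/setIP[com dS] /exists_inP[c cS /andP[edc lec]]].
  have [dB eda _] := comP d com; rewrite inE dS e_sym.
  have /max1/= le_c : ok c by rewrite /ok cS lec (edge_BA dB edc).
  by apply: (convex_edge dB c1A edc eda); apply/andP.
have Yr2 : #|Yr| <= 2.
  have [->|[d0]] := set_0Vmem Yr; first by rewrite cards0.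
  rewrite inE => /andP[/setIP[com0 _] /exists_inP[c0 c0S /andP[e0 le0]]].
  pose ok c := [&& c \in S, c \in A & pos a' <= pos c].
  have okc0 : ok c0 by rewrite /ok c0S le0 (edge_BA _ e0) //; have [] := comP d0 com0.
  have [c1 /and3P[c1S c1A le1] min1] := @arg_minnP _ c0 ok (fun c => pos c) okc0.
  apply: leq_trans (minimal_cds_degree minS c1S c1A); apply: subset_leq_card.
  apply/subsetP => d /setIdP[/setIP[com dS] /exists_inP[c cS /andP[edc lec]]].
  have [dB _ eda'] := comP d com; rewrite inE dS e_sym.
  have /min1/= le_c : ok c by rewrite /ok cS lec (edge_BA dB edc).
  by apply: (convex_edge dB c1A eda' edc); apply/andP.
suffices /subset_leq_card : common a a' :&: S \subset Yl :|: Yr.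
  by move/leq_trans; apply; apply: leq_trans (leq_card_setU _ _) _; rewrite (leq_add Yl2 Yr2).
apply/subsetP => d dX; have /setIP[dcom dS] := dX.
have [dB _ _] := comP d dcom; have [c cS edc] := cds_inner_neighbour minS.1 dS.
apply/setUP; case: (leqP (pos c) (pos a)) => [le_ca|lt_ac]; [left|right];
  apply/setIdP; split=> //; apply/exists_inP; exists c; rewrite // edc //= leqNgt.
apply: contraTN isT => lt_ca'; move/setP/(_ c): empty.
by rewrite !inE lt_ac lt_ca' cS (edge_BA dB edc).
Qed.

(** At most [t] positions, hence at most three members of [S], lie between. If there are none, only
    common neighbours count. Any member between is adjacent to all common neighbours, so at most two
    of these are in [S]; if there are three, none is, as it would span a triple. *)
Lemma minimal_cds_separator (S : {set T}) a a' :
    minimal_cds e S -> a \in A -> a' \in A -> pos a <= pos a' <= (pos a + t).+1 ->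
  #|(between a a' :|: common a a') :&: S| <= 4.
Proof.
move=> minS aA a'A close; rewrite setIUl.
apply: leq_trans (leq_card_setU _ _) _.
have g3 : #|between a a' :&: S| <= 3.
  apply: leq_trans (minimal_cds_window (pos a).+1 minS).
  by apply: subset_leq_card; apply: setSI; apply/subsetP => y; rewrite !inE; lia.
have [g0|[c]] := set_0Vmem (between a a' :&: S).
  by rewrite g0 cards0 minimal_cds_common //; case/andP: close.
rewrite !inE => /andP[/andP[cA cpos] cS].
have com d x : d \in common a a' -> x \in A -> pos a < pos x < pos a' -> e d x.
  rewrite inE => /andP[ead ea'd] xA /andP[lt_ax lt_xa']; have dB := edge_AB aA ead.
  rewrite e_sym in ead; rewrite e_sym in ea'd; apply: (convex_edge dB xA ead ea'd).
  by rewrite (ltnW lt_ax) ltnW.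
have h2 : #|common a a' :&: S| <= 2.
  apply: leq_trans (minimal_cds_degree minS cS cA); apply: subset_leq_card.
  by apply/subsetP => d /setIP[dcom dS]; rewrite inE dS e_sym com.
have [le2|gt2] := leqP #|between a a' :&: S| 2; first by move: le2 h2; clear; lia.
have [|s [sz sub srt]] := increasing_elements _ gt2.
  by apply/subsetP => x; rewrite !inE -andbA => /andP[].
case: s sz sub srt => [|c1 [|c2 [|c3 [|]]]] //= _ sub /and3P[lt12 lt23 _].
have cP x : x \in [:: c1; c2; c3] -> [/\ x \in S, x \in A & pos a < pos x < pos a'].
  by move/sub; rewrite !inE => /andP[/andP[]].
have [|c1S c1A p1] := cP c1; rewrite ?inE ?eqxx ?orbT //.
have [|c2S c2A p2] := cP c2; rewrite ?inE ?eqxx ?orbT //.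
have [|c3S c3A p3] := cP c3; rewrite ?inE ?eqxx ?orbT //.
suffices -> : common a a' :&: S = set0 by rewrite cards0 addn0 (leq_trans g3).
apply/setP => d; rewrite [RHS]inE; apply/negP => /setIP[dcom dS].
have := triple_not_spanned minS c1S c2S c3S c1A c2A c3A lt12 lt23 _ dS (com d c1 dcom c1A p1).
by rewrite (com d c3) // => /(_ _)/negP[]//; move: p1 p3 close; clear; lia.
Qed.

(** Outside [X], the vertices of [A] up to [a] and their neighbours form a closed set [K] missing
    [a']: an edge leaving [K] would start in a vertex of [B] with neighbours on both sides, by
    convexity a common neighbour of [a] and [a']. *)
Lemma separator_card a a' :
    a \in A -> a' \in A -> pos a < pos a' ->
  t <= #|between a a' :|: common a a'|.
Proof.
move=> aA a'A lt_aa'; rewrite leqNgt; apply/negP => small.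
set X := _ :|: _ in small.
pose K := [set x | if x \in A then pos x <= pos a else [exists y, e x y && (pos y <= pos a)]].
have XP x : x \in A -> x \notin X -> (pos x <= pos a) || (pos a' <= pos x).
  move=> xA; rewrite !inE xA; lia.
have aX : a \in ~: X.
  by rewrite !inE ltnn andbF /= ; apply/negP => /andP[]; rewrite e_irr.
have a'X : a' \in ~: X.
  by rewrite !inE ltnn !andbF /= ; apply/negP => /andP[]; rewrite e_irr.
have aK : a \in K by rewrite inE aA leqnn.
suffices clK : {in ~: X &, forall u w, u \in K -> e u w -> w \in K}.
  have := subsetP (connected_on_closed (t_conn.2 X small) aX aK clK) a' a'X.
  by rewrite inE a'A leqNgt lt_aa'.
move=> u w; rewrite !in_setC !(in_set, in_setU) => uX wX; case: ifP => [uA le_u euw|uA].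
  rewrite (edge_parts euw) uA; apply/existsP; exists u; rewrite e_sym euw le_u //.
move=> /existsP[y /andP[euy le_y]] euw; rewrite (edge_parts euw) uA /=.
have uB : u \in B by rewrite partB uA.
have wA := edge_BA uB euw.
have : (pos w <= pos a) || (pos a' <= pos w) by apply: XP; rewrite // !inE.
case: (leqP (pos w) (pos a)) => //= lt_w le_w; case/negP: uX; apply/orP; right.
rewrite ![e _ u]e_sym; apply/andP; split.
  by apply: (convex_edge uB aA euy euw); rewrite le_y ltnW.
by apply: (convex_edge uB a'A euy euw); rewrite le_w (leq_trans le_y) // ltnW.
Qed.

Definition remainder (L : seq {set T}) := [set x | all (fun S : {set T} => x \notin S) L].

(** Together the sets of [L] take at most [4 * size L] elements of [X], fewer than it has. *)
Lemma remainder_meets (L : seq {set T}) (X : {set T}) :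
    4 * size L < t -> t <= #|X| -> {in L, forall S, #|X :&: S| <= 4} ->
  exists2 x, x \in X & x \in remainder L.
Proof.
move=> Lt tX X4; apply/exists_inP; apply: contraT; rewrite negb_exists_in => /forall_inP hit.
suffices : #|[set x in X | x \notin remainder L]| <= 4 * size L.
  suffices -> : [set x in X | x \notin remainder L] = X by move: Lt tX; clear; lia.
  by apply/setP => x; rewrite inE; apply: andb_idr => /hit.
elim: L X4 {hit Lt} => [|S L IHL] X4.
  by rewrite muln0 leqn0 cards_eq0; apply/eqP/setP => x; rewrite !inE andbF.
have le4 := X4 S (mem_head _ _).
have {IHL} IHL := IHL (fun S' S'L => X4 S' (@mem_behead _ (S :: L) _ S'L)).
rewrite [size _]/= mulnS; apply: leq_trans (leq_add le4 IHL).
apply: leq_trans (leq_card_setU _ _); apply: subset_leq_card; apply/subsetP => x.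
by rewrite !inE /=; case: (x \in X); case: (x \in S).
Qed.

Lemma window_card i : i + t <= #|A| -> t <= #|[set y in A | i <= pos y < i + t]|.
Proof.
move=> it; set W := [set y in A | _].
have szA : size sigma = #|A| by rewrite -(card_uniqP sigma_uniq); apply: eq_card.
pose Y lo hi := [set y in A | lo <= pos y < hi].
have cardY lo hi : #|Y lo hi| <= hi - lo.
  by apply: card_pos_interval => [|y]; [apply/subsetP => y|]; rewrite inE => /andP[].
have : #|A :\: W| <= #|Y 0 i| + #|Y (i + t) #|A| |.
  apply: leq_trans (leq_card_setU _ _); apply: subset_leq_card; apply/subsetP => y.
  rewrite !inE => /andP[]; have [yA|//] := boolP (y \in A).
  have : pos y < #|A| by rewrite -szA index_mem sigma_A.
  by clear; lia.
have := cardsID W A; rewrite (setIidPr _); last by apply/subsetP => y; rewrite inE => /andP[].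
by have := cardY 0 i; have := cardY (i + t) #|A|; move: it; clear; lia.
Qed.

Lemma remainder_cds (L : seq {set T}) :
  4 * size L < t -> {in L, forall S, minimal_cds e S} -> cds e (remainder L).
Proof.
move=> Lt minL; set R := remainder L.
have meet_window i : i + t <= #|A| ->
    exists y, [/\ y \in R, y \in A & i <= pos y < i + t].
  move=> /window_card tW; have [|y] := remainder_meets Lt tW.
    by move=> S /minL/minimal_cds_window/leq_trans; apply.
  by rewrite inE => /andP[yA ypos] yR; exists y.
have pos_lt y : y \in A -> pos y < #|A|.
  move=> yA; have <- : size sigma = #|A| by rewrite -(card_uniqP sigma_uniq); apply: eq_card.
  by rewrite index_mem sigma_A.
(* From its leftmost neighbour [m], [b] reaches at least [t - 1] positions to the right, so it is
   adjacent to a whole window of [t] vertices, which the remainder meets. *)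
have domB b : b \in B -> exists y, [/\ y \in R, y \in A & e b y].
  move=> bB; have [c0 eb0 _] := neighbour_outside 0 bB.
  have [m ebm minm] := @arg_minnP _ c0 (e b) (fun c => pos c) eb0.
  have [x ebx /orP[|far]] := neighbour_outside (pos m) bB.
    by rewrite ltnNge minm.
  have ltx := pos_lt x (edge_BA bB ebx).
  have [|y [yR yA /andP[le_y lt_y]]] := meet_window (pos m); first exact: leq_trans ltx.
  exists y; split=> //; apply: (convex_edge bB yA ebm ebx).
  by rewrite le_y -ltnS (leq_trans lt_y).
(* For [a' = a] nothing lies between, and the common neighbours are the whole neighbourhood of
   [a]. *)
have domA a : a \in A -> exists2 b, b \in R & e a b.
  move=> aA; have comE : common a a = [set u | e a u].
    by apply/setP => u; rewrite !inE andbb.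
  have [||b] := @remainder_meets L (common a a) Lt.
  - by rewrite comE; apply: degree.
  - move=> S /minL minS; apply: minimal_cds_common => //.
    apply/setP => y; rewrite !inE; apply/negP => /andP[/andP[_ /andP[lt1 lt2]] _].
    by have := ltn_trans lt1 lt2; rewrite ltnn.
  by rewrite comE inE => eab bR; exists b.
(* By induction on the distance, only pairs with no remaining vertex of [A] between them have to be
   joined directly. *)
have conA a a' : a \in R -> a' \in R -> a \in A -> a' \in A -> pos a < pos a' ->
    connect (induced e R) a a'.
  have [n] := ubnP (pos a' - pos a).
  elim: n => // n IHn in a a' * => len aR a'R aA a'A lt_aa'.
  have [/exists_inP[y yR /and3P[yA lt1 lt2]]|] :=
      boolP [exists y in R, [&& y \in A, pos a < pos y & pos y < pos a']].
    by apply: (@connect_trans _ _ y); apply: IHn => //; move: len lt1 lt2; clear; lia.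
  rewrite negb_exists_in => /forall_inP none.
  (* If [a] and [a'] are far apart, a window fits between them and meets the remainder; otherwise
     the separator does, necessarily in a common neighbour. *)
  have [far|close] := leqP ((pos a).+1 + t) (pos a').
    have [|y [yR yA /andP[lt1 lt2]]] := meet_window (pos a).+1.
      by apply: leq_trans far _; apply: ltnW; apply: pos_lt.
    by have := none y yR; rewrite yA lt1 (leq_trans lt2 far).
  have [S SL|b] := remainder_meets Lt (separator_card aA a'A lt_aa').
    by apply: (minimal_cds_separator (minL S SL) aA a'A); rewrite (ltnW lt_aa') ltnW.
  move=> bX bR; case/setUP: bX => [/setIdP[bA /andP[lt1 lt2]]|].
    by have := none b bR; rewrite bA lt1 lt2.
  rewrite inE [e a' b]e_sym => /andP[eab eba'].
  by apply: (@connect_trans _ _ b); apply: connect1; apply/and3P.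
have [x0 _] : exists x0, x0 \in T by apply/card_gt0P; apply: leq_trans t_conn.1.
have [a0 [a0R a0A]] : exists a, a \in R /\ a \in A.
  have [x0A|] := boolP (x0 \in A); last by rewrite -partB => /domB[y [yR yA _]]; exists y.
  have [b _ ex0b] := domA _ x0A; have [y [yR yA _]] := domB b (edge_AB x0A ex0b).
  by exists y.
have hubA a : a \in R -> a \in A -> connect (induced e R) a a0.
  move=> aR aA; case: (ltngtP (pos a) (pos a0)) => [lt|lt|/pos_inj->//].
    exact: conA.
  by rewrite induced_connect_sym // conA.
split; first by apply/set0Pn; exists a0.
  apply: (@connected_on_hub _ _ e_sym _ a0) => x xR.
  have [/hubA->//|] := boolP (x \in A); rewrite -partB => /domB[y [yR yA exy]].
  by apply: connect_trans (hubA y yR yA); apply: connect1; rewrite /induced /= xR yR.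
move=> v _; have [/domA[b bR evb]|] := boolP (v \in A); first by exists b.
by rewrite -partB => /domB[y [yR _ evy]]; exists y.
Qed.

End Convex.

(** * Bounded loops over the input *)

Inductive source := Rounds | Vertices.

Inductive prog :=
| PSkip
| PAssign (x : nat) (a : expr)
| PSeq (p1 p2 : prog)
| PIf (a : expr) (p1 p2 : prog)
| PFor (src : source) (l : nat) (p : prog).

(** [Rounds] skips the first node of the unary [k], which leaves length [k - 1]; [Vertices] is the
    list of matrix rows. *)
Definition source_expr (src : source) : expr :=
  if src is Rounds then ERight (ELeft (EVar 0)) else ERight (EVar 0).

(* In [PFor src l p], variable [l] holds the rest of the list being traversed. *)
Fixpoint compile (p : prog) : cmd :=
  match p with
  | PSkip => CSkip
  | PAssign x a => CAssign x a
  | PSeq p1 p2 => CSeq (compile p1) (compile p2)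
  | PIf a p1 p2 => CIf a (compile p1) (compile p2)
  | PFor src l p =>
      CSeq (CAssign l (source_expr src))
           (CWhile (EVar l) (CSeq (CAssign l (ERight (EVar l))) (compile p)))
  end.

Fixpoint spine (a : tree) : nat := if a is Node _ r then (spine r).+1 else 0.

Definition test (a : tree) : bool := if a is Node _ _ then true else false.

Fixpoint run (p : prog) (s : store) : store :=
  match p with
  | PSkip => s
  | PAssign x a => update s x (eval s a)
  | PSeq p1 p2 => run p2 (run p1 s)
  | PIf a p1 p2 => if test (eval s a) then run p1 s else run p2 s
  | PFor src l p =>
      let a := eval s (source_expr src) in
      iter (spine a) (fun s => run p (update s l (right_of (s l)))) (update s l a)
  end.

Fixpoint assigned (p : prog) : seq nat :=
  match p with
  | PSkip => [::]
  | PAssign x _ => [:: x]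
  | PSeq p1 p2 | PIf _ p1 p2 => assigned p1 ++ assigned p2
  | PFor _ l p => l :: assigned p
  end.

(* Variable 0 keeps the input, and loop counters are not tampered with. *)
Fixpoint wf (p : prog) : bool :=
  match p with
  | PSkip => true
  | PAssign x _ => x != 0
  | PSeq p1 p2 | PIf _ p1 p2 => wf p1 && wf p2
  | PFor _ l p => [&& l != 0, l \notin assigned p & wf p]
  end.

Lemma run_unassigned p s x : x \notin assigned p -> run p s x = s x.
Proof.
elim: p s => //= [y a|p1 IH1 p2 IH2|a p1 IH1 p2 IH2|src l p IH] s.
- by rewrite inE /update => /negPf->.
- by rewrite mem_cat negb_or => /andP[x1 x2]; rewrite IH2 ?IH1.
- by rewrite mem_cat negb_or => /andP[x1 x2]; case: ifP => _; rewrite ?IH2 ?IH1.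
- rewrite inE negb_or => /andP[/negPf xl xp].
  by elim: (spine _) => [|n IHn] /=; rewrite ?IH // /update xl.
Qed.

Lemma wf_assigned p : wf p -> 0 \notin assigned p.
Proof.
elim: p => //= [x a|p1 IH1 p2 IH2|a p1 IH1 p2 IH2|src l p IH].
- by rewrite inE eq_sym.
- by rewrite mem_cat negb_or => /andP[/IH1-> /IH2->].
- by rewrite mem_cat negb_or => /andP[/IH1-> /IH2->].
- by rewrite inE negb_or eq_sym => /and3P[-> _ /IH].
Qed.

(** [n] bounds the input size. The 6 pays for the test, for shortening the counter, and for [CSeq]
    and [CWhile]; the 7 for the initial assignment, its [CSeq] and the final failing test. *)
Fixpoint time_bound (p : prog) (n : nat) : nat :=
  match p with
  | PSkip => 1
  | PAssign _ a => (eval_cost a).+1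
  | PSeq p1 p2 => (time_bound p1 n + time_bound p2 n).+1
  | PIf a p1 p2 => (eval_cost a + (time_bound p1 n + time_bound p2 n)).+1
  | PFor _ _ p => n * (time_bound p n + 6) + 7
  end.

Lemma test_nonleaf a : test a -> a <> Leaf.
Proof. by case: a. Qed.

Lemma spine_size a : spine a <= tree_size a.
Proof. by elim: a => //= l _ r; lia. Qed.

Lemma spine_source s src n :
  tree_size (s 0) <= n -> spine (eval s (source_expr src)) <= n.
Proof.
move=> le_n; apply: leq_trans le_n; case: src => /=.
  case: (s 0) => //= l r; case: l => //= ll lr.
  by apply: leq_trans (spine_size _) _; lia.
by case: (s 0) => //= l r; apply: leq_trans (spine_size _) _; lia.
Qed.

(** Variable 0 is never assigned, so every traversed list has length at most [n]; a body leaves its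
    counter alone, so each iteration removes exactly one node. *)
Lemma compile_exec p s n : wf p -> tree_size (s 0) <= n ->
  exists2 t, exec s (compile p) (run p s) t & t <= time_bound p n.
Proof.
elim: p s => //= [|x a|p1 IH1 p2 IH2|a p1 IH1 p2 IH2|src l p IH] s.
- by exists 1; first constructor.
- by exists (eval_cost a).+1; first constructor.
- move=> /andP[wf1 wf2] le_n.
  have [t1 ex1 le1] := IH1 s wf1 le_n.
  have [|t2 ex2 le2] := IH2 (run p1 s) wf2; first by rewrite run_unassigned ?wf_assigned.
  by exists (t1 + t2).+1; [apply: exec_seq ex1 ex2 | rewrite ltnS leq_add].
- move=> /andP[wf1 wf2] le_n.
  have [t1 ex1 le1] := IH1 s wf1 le_n; have [t2 ex2 le2] := IH2 s wf2 le_n.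
  have [/test_nonleaf nz|] := boolP (test (eval s a)).
    by exists (eval_cost a + t1).+1; [apply: exec_if_true | lia].
  move=> z; exists (eval_cost a + t2).+1; [apply: exec_if_false => // | lia].
  by case: (eval s a) z.
- move=> /and3P[l0 lp wfp] le_n; set a := eval s _.
  pose body := fun s => run p (update s l (right_of (s l))).
  have body0 s' : body s' 0 = s' 0.
    by rewrite /body run_unassigned ?wf_assigned // /update eq_sym (negPf l0).
  have loop m s' : spine (s' l) = m -> tree_size (s' 0) <= n ->
      exists2 t, exec s' (CWhile (EVar l) (CSeq (CAssign l (ERight (EVar l))) (compile p)))
                   (iter m body s') t & t <= m * (time_bound p n + 6) + 2.
    elim: m s' => [|m IHm] s' sz le_n'.
      exists 2 => //; apply: (@exec_while_false s' (EVar l)) => /=.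
      by case: (s' l) sz.
    have [|t1 ex1 le1] := IH (update s' l (right_of (s' l))) wfp.
      by rewrite /update eq_sym (negPf l0).
    have [||t2 ex2 le2] := IHm (body s').
    - by rewrite /body run_unassigned // /update eqxx; case: (s' l) sz => //= ? r [].
    - by rewrite body0.
    rewrite iterSr; exists (1 + (3 + t1).+1 + t2).+1; last first.
      by rewrite mulSn; move: le1 le2; clear; lia.
    apply: (@exec_while_true s' (body s')) ex2; first by rewrite /=; case: (s' l) sz.
    by apply: exec_seq ex1; apply: (@exec_assign s' l (ERight (EVar l))).
  have le_a : spine a <= n by apply: spine_source.
  have [||t ex le_t] := loop (spine a) (update s l a).
  - by rewrite /update eqxx.
  - by rewrite /update eq_sym (negPf l0).
  exists ((eval_cost (source_expr src)).+1 + t).+1.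
    by apply: exec_seq ex; apply: exec_assign.
  have : eval_cost (source_expr src) <= 3 by case: src {a le_a loop ex le_t}.
  have : spine a * (time_bound p n + 6) <= n * (time_bound p n + 6) by rewrite leq_mul2r le_a orbT.
  by move: le_t; clear; lia.
Qed.

Lemma time_bound_polynomial p :
  exists c d, forall n, 0 < n -> time_bound p n <= c * n ^ d.
Proof.
have widen c c' d d' n : 0 < n -> c <= c' -> d <= d' -> c * n ^ d <= c' * n ^ d'.
  by move=> n0 cc dd; rewrite leq_mul // leq_pexp2l.
elim: p => /= [|x a|p1 [c1 [d1 le1]] p2 [c2 [d2 le2]]
    |a p1 [c1 [d1 le1]] p2 [c2 [d2 le2]]|src l p [c [d le_p]]].
- by exists 1, 0.
- by exists (eval_cost a).+1, 0 => n _; rewrite muln1.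
- exists (c1 + c2).+1, (d1 + d2) => n n0.
  have le1' := leq_trans (le1 n n0) (widen _ _ _ _ _ n0 (leqnn _) (leq_addr d2 d1)).
  have le2' := leq_trans (le2 n n0) (widen _ _ _ _ _ n0 (leqnn _) (leq_addl d1 d2)).
  have pos_n : 0 < n ^ (d1 + d2) by rewrite expn_gt0 n0.
  by rewrite mulSn mulnDl; move: pos_n le1' le2'; clear; lia.
- exists (eval_cost a + c1 + c2).+1, (d1 + d2) => n n0.
  have le1' := leq_trans (le1 n n0) (widen _ _ _ _ _ n0 (leqnn _) (leq_addr d2 d1)).
  have le2' := leq_trans (le2 n n0) (widen _ _ _ _ _ n0 (leqnn _) (leq_addl d1 d2)).
  have := widen (eval_cost a).+1 (eval_cost a).+1 0 (d1 + d2) n n0 (leqnn _) (leq0n _).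
  rewrite muln1 => pos_n.
  have -> : (eval_cost a + c1 + c2).+1 = (eval_cost a).+1 + c1 + c2 by rewrite !addSn.
  by rewrite !mulnDl; move: pos_n le1' le2'; clear; lia.
(* A loop raises the degree by one; its overheads 6 and 7 are absorbed into [n ^ d.+1]. *)
- exists (c + 13), d.+1 => n n0; have le_c := le_p n n0.
  have -> : (c + 13) * n ^ d.+1 = n * (c * n ^ d + 6 * n ^ d) + 7 * n ^ d.+1.
    by rewrite mulnDr expnS; lia.
  have pos_n m : 0 < n ^ m by rewrite expn_gt0 n0.
  apply: leq_add; last by rewrite -{1}(muln1 7) leq_mul2l pos_n.
  by rewrite leq_mul2l leq_add ?orbT // -{1}(muln1 6) leq_mul2l pos_n.
Qed.

(** * The greedy algorithm and its program *)

Section Algorithm.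
Variables (T : finType) (e : rel T).
Implicit Types (S Q R : {set T}).

(** Vertices outside [S] may enter, but only members of [S] pass the growth on; thus one closure
    tests connectivity and domination together. *)
Definition grow S Q := Q :|: [set x | [exists u in Q :&: S, e x u]].

(* The last element of [S] in [enum T], as a singleton; empty if [S] is. *)
Definition root S := foldl (fun Q x => if x \in S then [set x] else Q) set0 (enum T).

Definition spans S := iter #|T| (grow S) (root S) == [set: T].

Definition thin S v := if spans (S :\ v) then S :\ v else S.

Definition minimize R := foldl thin R (enum T).

Definition round (st : {set T} * seq {set T}) :=
  let S := minimize st.1 in (st.1 :\: S, S :: st.2).

Definition greedy k := iter k.-1 round ([set: T], [::]).

End Algorithm.

(** The numbers left out between 1 and 29 are the loop counters; nested loops use different ones. *)
Local Notation vR := 1 (only parsing).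
Local Notation vOut := 2 (only parsing).
Local Notation vS := 3 (only parsing).
Local Notation vC := 4 (only parsing).
Local Notation vMask := 5 (only parsing).
Local Notation vQ := 6 (only parsing).
Local Notation vA := 7 (only parsing).
Local Notation vB := 8 (only parsing).
Local Notation vD := 9 (only parsing).
Local Notation vTmp := 10 (only parsing).
Local Notation vRow := 13 (only parsing).
Local Notation vQQ := 14 (only parsing).
Local Notation vSS := 15 (only parsing).
Local Notation vF := 16 (only parsing).
Local Notation vRows := 18 (only parsing).
Local Notation vQP := 19 (only parsing).
Local Notation vMM := 21 (only parsing).
Local Notation vCC := 22 (only parsing).
Local Notation vAQ := 24 (only parsing).
Local Notation vOk := 25 (only parsing).

Declare Scope prog_scope.
Delimit Scope prog_scope with prog.
Local Notation "x ::= a" := (PAssign x a) (at level 60) : prog_scope.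
Local Notation "p ;; q" := (PSeq p q) (at level 70, right associativity) : prog_scope.
Local Notation ETrue := (ENode ELeaf ELeaf) (only parsing).

Definition pop (x : nat) : prog := PAssign x (ERight (EVar x)).

(* [body] computes one entry in [vF]; the entries are accumulated in [vTmp] in
   reverse order, then reversed into [vD]. *)
Definition p_map (body : prog) : prog :=
  (vTmp ::= ELeaf ;;
   PFor Vertices 11 (body ;; vTmp ::= ENode (EVar vF) (EVar vTmp)) ;;
   vD ::= ELeaf ;;
   PFor Vertices 12 (vD ::= ENode (ELeft (EVar vTmp)) (EVar vD) ;; pop vTmp))%prog.

Definition p_diff_body : prog :=
  (PIf (ELeft (EVar vB)) (vF ::= ELeaf) (vF ::= ELeft (EVar vA)) ;;
   pop vA ;; pop vB)%prog.

Definition p_adj_body : prog :=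
  (PIf (ELeft (EVar vRow))
     (PIf (ELeft (EVar vQQ))
       (PIf (ELeft (EVar vSS)) (vF ::= ETrue) PSkip) PSkip) PSkip ;;
   pop vRow ;; pop vQQ ;; pop vSS)%prog.

Definition p_adj : prog :=
  (vQQ ::= EVar vQ ;; vSS ::= EVar vC ;; vF ::= ELeaf ;; PFor Vertices 17 p_adj_body)%prog.

Definition p_grow_body : prog :=
  (vRow ::= ELeft (EVar vRows) ;; pop vRows ;; p_adj ;;
   PIf (ELeft (EVar vQP)) (vF ::= ETrue) PSkip ;; pop vQP)%prog.

(** [vQ] is kept until all new entries are computed, so all vertices are added simultaneously; the
    copy [vQP] is consumed. *)
Definition p_grow : prog :=
  (vRows ::= ERight (EVar 0) ;; vQP ::= EVar vQ ;; p_map p_grow_body ;; vQ ::= EVar vD)%prog.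

Definition p_root_body : prog :=
  (PIf (ELeft (EVar vCC)) (vQ ::= EVar vMM) PSkip ;;
   vMM ::= ENode ELeaf (EVar vMM) ;; pop vCC)%prog.

Definition p_root : prog :=
  (vMM ::= ENode ETrue ELeaf ;; vCC ::= EVar vC ;; vQ ::= ELeaf ;;
   PFor Vertices 23 p_root_body)%prog.

Definition p_all_body : prog :=
  (PIf (ELeft (EVar vAQ)) PSkip (vOk ::= ELeaf) ;; pop vAQ)%prog.

Definition p_all : prog :=
  (vOk ::= ETrue ;; vAQ ::= EVar vQ ;; PFor Vertices 26 p_all_body)%prog.

Definition p_spans : prog := (p_root ;; PFor Vertices 20 p_grow ;; p_all)%prog.

Definition p_thin : prog :=
  (vA ::= EVar vS ;; vB ::= EVar vMask ;; p_map p_diff_body ;; vC ::= EVar vD ;;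
   p_spans ;; PIf (EVar vOk) (vS ::= EVar vC) PSkip ;;
   vMask ::= ENode ELeaf (EVar vMask))%prog.

Definition p_minimize : prog :=
  (vS ::= EVar vR ;; vMask ::= ENode ETrue ELeaf ;; PFor Vertices 27 p_thin)%prog.

Definition p_round : prog :=
  (p_minimize ;; vOut ::= ENode (EVar vS) (EVar vOut) ;;
   vA ::= EVar vR ;; vB ::= EVar vS ;; p_map p_diff_body ;; vR ::= EVar vD)%prog.

Definition p_greedy : prog :=
  (vR ::= ELeaf ;; PFor Vertices 29 (vR ::= ENode ETrue (EVar vR)) ;;
   vOut ::= ELeaf ;; PFor Rounds 28 p_round)%prog.

Definition p_main : cmd := CSeq (compile p_greedy) (CAssign 0 (ENode (EVar vR) (EVar vOut))).

Arguments run : simpl never.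
Arguments assigned : simpl never.

Lemma run_seq p1 p2 s : run (PSeq p1 p2) s = run p2 (run p1 s).
Proof. by []. Qed.

Lemma run_assign x a s : run (PAssign x a) s = update s x (eval s a).
Proof. by []. Qed.

Lemma run_if a p1 p2 s :
  run (PIf a p1 p2) s = if test (eval s a) then run p1 s else run p2 s.
Proof. by []. Qed.

Lemma run_skip s : run PSkip s = s.
Proof. by []. Qed.

Definition runE := (run_seq, run_assign, run_if, run_skip).

Lemma test_enc_bool b : test (enc_bool b) = b.
Proof. by case: b. Qed.

(** * The programs compute the functions on sets *)

Section Correctness.
Variables (T : finType) (e : rel T) (k : nat).

Definition bits (l : seq T) (P : pred T) : tree := enc_seq (fun x => enc_bool (P x)) l.

(* Weaker than [a = bits l P]: [a] may be shorter than [l], the missing bits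
   being read as [false]. *)
Fixpoint reads (l : seq T) (P : pred T) (a : tree) : bool :=
  if l is x :: l' then (test (left_of a) == P x) && reads l' P (right_of a) else true.

Lemma reads_bits l P : reads l P (bits l P).
Proof. by elim: l => //= x l ->; rewrite test_enc_bool eqxx. Qed.

Lemma eq_reads l P P' a : P =1 P' -> reads l P a = reads l P' a.
Proof. by move=> eqP; elim: l a => //= x l IH a; rewrite IH eqP. Qed.

Lemma bits_set S : enc_set S = bits (enum T) (mem S).
Proof. by []. Qed.

Lemma eq_bits l P P' : P =1 P' -> bits l P = bits l P'.
Proof. by move=> eqP; elim: l => //= x l IH; rewrite IH eqP. Qed.

(** The characteristic vector of the vertex with index [m], cut off after that entry, so that one
    [Node] moves it to the next vertex; [reads] supplies the missing bits. *)
Definition mask (m : nat) : tree := iter m (Node Leaf) (Node (Node Leaf Leaf) Leaf).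

Lemma reads_mask (pre post : seq T) v :
  uniq (pre ++ v :: post) -> reads (pre ++ v :: post) (pred1 v) (mask (size pre)).
Proof.
elim: pre => /= [/andP[vpost _]|x pre IH /andP[xP /IH->]].
  rewrite eqxx /=; elim: post vpost => //= y post IH.
  by rewrite inE negb_or eq_sym => /andP[/negPf-> /IH].
suffices /negPf-> : x != v by [].
by apply: contraNneq xP => ->; rewrite mem_cat mem_head orbT.
Qed.

Lemma spine_enc_seq (X : Type) (f : X -> tree) l : spine (enc_seq f l) = size l.
Proof. by elim: l => //= x l ->. Qed.

Definition input_ok (s : store) := s 0 = enc_instance e k.

Lemma run_input p s : 0 \notin assigned p -> input_ok s -> input_ok (run p s).
Proof. by move=> p0 s0; rewrite /input_ok run_unassigned. Qed.

Lemma run_for l p s : input_ok s ->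
  run (PFor Vertices l p) s =
  iter (size (enum T)) (fun s => run p (update s l (right_of (s l))))
       (update s l (right_of (s 0))).
Proof. by move=> s0; rewrite {1}/run -/run /= s0 /= spine_enc_seq. Qed.

Lemma map_loop (Inv : seq T -> store -> Prop) f body l s :
    vTmp \notin assigned body ->
    (forall x l s v, Inv (x :: l) s ->
       let s' := run body (update s 11 v) in
       s' vF = f x /\ forall w, Inv l (update s' vTmp w)) ->
    Inv l s ->
  forall d, s vTmp = enc_seq id d ->
  iter (size l) (fun s => run (PSeq body (PAssign vTmp (ENode (EVar vF) (EVar vTmp))))
                              (update s 11 (right_of (s 11)))) s vTmp
    = enc_seq id (catrev (map f l) d).
Proof.
move=> tmp_body step; elim: l s => [|x l IH] s inv d s_d //.
rewrite [size _]/= iterSr !runE /=; set s' := run body _.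
have := step x l s (right_of (s 11)) inv; rewrite -/s' => -[s'F inv'].
apply: IH; first exact: inv'.
by rewrite /update /= s'F /s' run_unassigned // /update /= s_d.
Qed.

Lemma reverse_loop (d : seq tree) s out :
    s vTmp = enc_seq id d -> s vD = enc_seq id out ->
  iter (size d) (fun s => run (PSeq (PAssign vD (ENode (ELeft (EVar vTmp)) (EVar vD))) (pop vTmp))
                              (update s 12 (right_of (s 12)))) s vD
    = enc_seq id (catrev d out).
Proof.
elim: d s out => [|x d IH] s out s_d s_out //; rewrite [size _]/= iterSr.
by apply: IH; rewrite /pop !runE /update /= s_d ?s_out.
Qed.

Lemma run_map (Inv : seq T -> store -> Prop) f body s :
    vTmp \notin assigned body -> 0 \notin assigned body ->
    (forall x l s v, Inv (x :: l) s ->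
       let s' := run body (update s 11 v) in
       s' vF = f x /\ forall w, Inv l (update s' vTmp w)) ->
    (forall v, Inv (enum T) (update (update s vTmp Leaf) 11 v)) -> input_ok s ->
  run (p_map body) s vD = enc_seq f (enum T).
Proof.
move=> tmp_body body0 step inv s0; rewrite /p_map !run_seq !run_assign.
set s1 := run (PFor _ 11 _) _.
have s1_tmp : s1 vTmp = enc_seq id (catrev (map f (enum T)) [::]).
  by rewrite /s1 run_for //; apply: (map_loop tmp_body step).
have s1_0 : input_ok s1.
  apply: run_input => //; rewrite -[assigned _]/(11 :: (assigned body ++ [:: vTmp])).
  by rewrite inE mem_cat !negb_or body0.
rewrite run_for //.
have -> : size (enum T) = size (catrev (map f (enum T)) [::]) by rewrite catrevE cats0 size_rev size_map.
rewrite (reverse_loop (out := [::])) //.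
rewrite !catrevE !cats0 revK; by elim: (enum T) => //= x l ->.
Qed.

Lemma run_diff (P M : pred T) s :
    input_ok s -> s vA = bits (enum T) P -> reads (enum T) M (s vB) ->
  run (p_map p_diff_body) s vD = bits (enum T) (fun x => P x && ~~ M x).
Proof.
move=> s0 sA sB.
apply: (run_map (Inv := fun l s => s vA = bits l P /\ reads l M (s vB))) => //.
move=> x l s' v [s'A s'B] /=; rewrite /p_diff_body /pop !runE /update /=.
move: s'B => /= /andP[/eqP-> rB]; rewrite s'A /=.
by case: (M x); rewrite ?andbT ?andbF /=; split=> // _; rewrite s'A.
Qed.

Lemma run_adj v (P S : pred T) s :
    input_ok s -> s vRow = bits (enum T) (e v) ->
    reads (enum T) P (s vQ) -> reads (enum T) S (s vC) ->
  run p_adj s vF = enc_bool (has (fun u => [&& e v u, P u & S u]) (enum T)).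
Proof.
move=> s0 sRow sQ sC; rewrite /p_adj !run_seq !run_assign run_for //=.
set s1 := update _ 17 _.
have : [/\ s1 vRow = bits (enum T) (e v), reads (enum T) P (s1 vQQ),
           reads (enum T) S (s1 vSS) & s1 vF = enc_bool false] by [].
rewrite -[has _ _]/(false || has (fun u => [&& e v u, P u & S u]) (enum T)).
elim: (enum T) s1 false => [|u l IH] s1 b [s1R s1Q s1S s1F].
  by rewrite /= orbF.
rewrite [size _]/= iterSr /= orbA; apply: IH.
move: s1Q s1S => /= /andP[/eqP tQ rQ] /andP[/eqP tS rS].
rewrite /p_adj_body /pop !runE /update /= s1R tQ tS test_enc_bool.
by case: (e v u); case: (P u); case: (S u); rewrite /= ?tQ ?tS ?s1R ?s1F /= ?orbT ?orbF.
Qed.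

Lemma run_grow (S Q : {set T}) s :
    input_ok s -> reads (enum T) (mem Q) (s vQ) -> reads (enum T) (mem S) (s vC) ->
  reads (enum T) (mem (grow e S Q)) (run p_grow s vQ).
Proof.
move=> s0 sQ sC; rewrite /p_grow 3!run_seq !run_assign [update _ vQ _ _]/update /=.
set f := fun x => (x \in Q) || has (fun u => [&& e x u, u \in Q & u \in S]) (enum T).
rewrite (run_map (f := fun x => enc_bool (f x)) (Inv := fun l s =>
  [/\ input_ok s, s vRows = enc_seq (fun x => bits (enum T) (e x)) l, reads l (mem Q) (s vQP),
      reads (enum T) (mem Q) (s vQ) & reads (enum T) (mem S) (s vC)])) //; first last.
- by move=> v; split=> //; rewrite /update /= s0.
- move=> x l s' v [s'0 s'Rows s'QP s'Q s'C] /=.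
  rewrite /p_grow_body /pop 4!run_seq !run_assign run_if run_skip run_assign.
  set s1 := update (update (update s' 11 v) vRow _) vRows _.
  have adjE : run p_adj s1 vF = enc_bool (has (fun u => [&& e x u, u \in Q & u \in S]) (enum T)).
    by apply: run_adj; rewrite // /s1 /update /= s'Rows.
  set s2 := run p_adj s1 in adjE *.
  have frame y : y \notin assigned p_adj -> s2 y = s1 y by apply: run_unassigned.
  move: s'QP => /= /andP[/eqP tQP rQP].
  rewrite -/s2 /= [s2 vQP]frame // [s1 vQP]/= tQP.
  split.
    by rewrite /f; case: ifP => xQ; rewrite /update /= ?adjE.
  by move=> w; split; case: ifP => _; rewrite /input_ok /update /= frame //= /s1 /update /= ?s'Rows.
- rewrite -(eq_reads _ (P := f)) ?reads_bits // => x.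
  rewrite /f /= !inE; congr (_ || _); apply/hasP/exists_inP.
    by move=> [u _ /and3P[exu uQ uS]]; exists u; rewrite // inE uQ.
  by move=> [u /setIP[uQ uS] exu]; exists u; rewrite ?mem_enum // exu uQ.
Qed.

Lemma run_root (S : {set T}) s :
    input_ok s -> reads (enum T) (mem S) (s vC) ->
  reads (enum T) (mem (root S)) (run p_root s vQ).
Proof.
move=> s0 sC; rewrite /p_root !run_seq !run_assign run_for //=.
suffices gen l pre (Q : {set T}) s1 : enum T = pre ++ l ->
    [/\ s1 vMM = mask (size pre), reads l (mem S) (s1 vCC) & reads (enum T) (mem Q) (s1 vQ)] ->
    reads (enum T) (mem (foldl (fun Q x => if x \in S then [set x] else Q) Q l))
      (iter (size l) (fun s => run p_root_body (update s 23 (right_of (s 23)))) s1 vQ).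
  apply: (gen _ [::]) => //; split=> //; rewrite /update /=.
  (* The initial [Leaf] reads as the empty set. *)
  by elim: (enum T) => //= x l ->; rewrite inE.
elim: l pre Q s1 => [|x l IH] pre Q s1 def_enum [sMM sCC sQ] //.
rewrite [size _]/= iterSr /=; apply: (IH (rcons pre x)); first by rewrite cat_rcons.
move: sCC => /= /andP[/eqP tCC rCC]; rewrite size_rcons.
rewrite /p_root_body /pop !runE /= {1}/update /= tCC.
case: (x \in S); rewrite /update /= sMM; split=> //.
have -> : reads (enum T) (mem [set x]) =1 reads (enum T) (pred1 x).
  by move=> a; apply: eq_reads => y; rewrite /= inE.
by rewrite def_enum reads_mask // -def_enum enum_uniq.
Qed.

Lemma run_all (Q : {set T}) s :
    input_ok s -> reads (enum T) (mem Q) (s vQ) ->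
  test (run p_all s vOk) = (Q == [set: T]).
Proof.
move=> s0 sQ; rewrite /p_all !run_seq !run_assign run_for //=.
set s1 := update _ 26 _.
have -> : (Q == [set: T]) = true && all (mem Q) (enum T).
  apply/eqP/allP => [-> x _|full]; first by rewrite inE.
  by apply/setP => x; rewrite inE; apply: full; rewrite mem_enum.
have : test (s1 vOk) = true /\ reads (enum T) (mem Q) (s1 vAQ) by [].
elim: (enum T) s1 true => [|x l IH] s1 b [s1Ok s1Q]; first by rewrite andbT.
rewrite [size _]/= iterSr /= andbA; apply: IH.
move: s1Q => /= /andP[/eqP tQ rQ]; rewrite /p_all_body /pop !runE /= {1}/update /= tQ.
by case: (x \in Q); rewrite /update /= ?andbT ?andbF.
Qed.

Lemma run_spans (S : {set T}) s :
    input_ok s -> reads (enum T) (mem S) (s vC) ->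
  test (run p_spans s vOk) = spans e S.
Proof.
move=> s0 sC; rewrite /p_spans 2!run_seq.
set s1 := run p_root s; rewrite run_for; last exact: run_input.
set loop := iter _ _ _.
suffices [? ?] : input_ok loop /\ reads (enum T) (mem (iter #|T| (grow e S) (root S))) (loop vQ).
  exact: run_all.
suffices [] : [/\ input_ok loop, reads (enum T) (mem (iter #|T| (grow e S) (root S))) (loop vQ)
    & reads (enum T) (mem S) (loop vC)] by [].
rewrite /loop -cardE; elim: #|T| => [|n [IH0 IHQ IHC]].
  split; first exact: (@run_input p_root).
    exact: run_root.
  by rewrite /= {1}/update /= /s1 run_unassigned.
rewrite !iterS; set s2 := iter n _ _ in IH0 IHQ IHC *; split.
- exact: run_input.
- exact: run_grow.
- by rewrite run_unassigned.
Qed.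

Lemma run_minimize (X : {set T}) s :
  input_ok s -> s vR = enc_set X -> run p_minimize s vS = enc_set (minimize e X).
Proof.
move=> s0 sR; rewrite /p_minimize !run_seq !run_assign run_for //=.
suffices gen l pre Y s1 : enum T = pre ++ l ->
    [/\ input_ok s1, s1 vMask = mask (size pre) & s1 vS = enc_set Y] ->
    iter (size l) (fun s => run p_thin (update s 27 (right_of (s 27)))) s1 vS
      = enc_set (foldl (thin e) Y l).
  by apply: (gen _ [::]).
elim: l pre Y s1 => [|x l IH] pre Y s1 def_enum [s1_0 sMask sS] //.
rewrite [size _]/= iterSr /=; apply: (IH (rcons pre x)); first by rewrite cat_rcons.
rewrite size_rcons /p_thin 6!run_seq !run_assign run_if run_assign run_skip.
set s2 := update (update _ _ _) _ _.
have s2D : run (p_map p_diff_body) s2 vD = enc_set (Y :\ x).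
  rewrite (@run_diff (mem Y) (pred1 x)) //.
    by apply: eq_bits => y; rewrite /= !inE andbC.
  by rewrite def_enum /s2 /update /= sMask reads_mask // -def_enum enum_uniq.
set s3 := update _ vC _.
have s3C : s3 vC = enc_set (Y :\ x) by rewrite /s3 /update /= s2D.
have s3_0 : input_ok s3 by apply: (@run_input (p_map p_diff_body)).
have okE : test (run p_spans s3 vOk) = spans e (Y :\ x).
  by apply: run_spans; rewrite // s3C bits_set reads_bits.
have frame y : y \notin assigned p_spans -> run p_spans s3 y = s3 y by apply: run_unassigned.
have s3S : s3 vS = enc_set Y by rewrite /s3 /update /= run_unassigned.
have s3Mask : s3 vMask = mask (size pre) by rewrite /s3 /update /= run_unassigned.
rewrite /= okE /thin.
by case: (spans _ _); rewrite /input_ok /update /= !frame // ?s3_0 ?s3Mask ?s3S ?s3C.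
Qed.

Lemma run_round (st : {set T} * seq {set T}) s :
    input_ok s -> s vR = enc_set st.1 -> s vOut = enc_seq (@enc_set T) st.2 ->
  let s' := run p_round s in
  [/\ input_ok s', s' vR = enc_set (round e st).1 &
      s' vOut = enc_seq (@enc_set T) (round e st).2].
Proof.
move=> s0 sR sOut /=; rewrite /p_round 5!run_seq !run_assign.
have minE := run_minimize s0 sR.
set s1 := run p_minimize s in minE *.
have frame y : y \notin assigned p_minimize -> s1 y = s y by apply: run_unassigned.
set s2 := update (update (update _ _ _) _ _) _ _.
have s2D : run (p_map p_diff_body) s2 vD = enc_set (st.1 :\: minimize e st.1).
  rewrite (@run_diff (mem st.1) (mem (minimize e st.1))) //.
  - by apply: eq_bits => y; rewrite /= !inE andbC.
  - by rewrite /input_ok /s2 /update /= frame.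
  - by rewrite /s2 /update /= frame.
  - by rewrite /s2 /update /= minE bits_set reads_bits.
have frame2 y : y \notin assigned (p_map p_diff_body) -> run (p_map p_diff_body) s2 y = s2 y.
  exact: run_unassigned.
split; rewrite /input_ok /update /= ?s2D ?frame2 // /s2 /update /=.
  by rewrite frame.
by rewrite minE frame // sOut.
Qed.

Lemma run_greedy s : input_ok s ->
  let s' := run p_greedy s in
  s' vR = enc_set (greedy e k).1 /\ s' vOut = enc_seq (@enc_set T) (greedy e k).2.
Proof.
move=> s0 /=; rewrite /p_greedy !run_seq !run_assign.
set s1 := run (PFor _ 29 _) _.
have s1R : s1 vR = enc_set [set: T].
  rewrite /s1 run_for //; set s2 := update _ _ _.
  suffices -> l : iter (size l) (fun s => run (PAssign vR (ENode ETrue (EVar vR)))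
      (update s 29 (right_of (s 29)))) s2 vR = bits l (mem [set: T]) by [].
  elim: l => //= x l IH; set s3 := iter _ _ _ in IH *.
  by rewrite runE /update /= IH inE.
have s1_0 : input_ok s1 by apply: run_input.
have -> : forall p s, run (PFor Rounds 28 p) s =
    iter (spine (right_of (left_of (s 0)))) (fun s => run p (update s 28 (right_of (s 28))))
      (update s 28 (right_of (left_of (s 0)))) by [].
rewrite [update _ _ _ 0]/update /= s1_0 /=.
(* One round fewer than there are parts: the last part is what remains. *)
have -> : spine (right_of (enc_nat k)) = k.-1.
  by case: k => //= m; elim: m => //= m ->.
set s2 := update _ _ _; rewrite /greedy.
suffices [] : [/\ input_ok (iter k.-1 (fun s => run p_round (update s 28 (right_of (s 28)))) s2),
   iter k.-1 (fun s => run p_round (update s 28 (right_of (s 28)))) s2 vR =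
     enc_set (iter k.-1 (round e) ([set: T], [::])).1 &
   iter k.-1 (fun s => run p_round (update s 28 (right_of (s 28)))) s2 vOut =
     enc_seq (@enc_set T) (iter k.-1 (round e) ([set: T], [::])).2] by [].
elim: k.-1 => [|m [IH0 IHR IHOut]]; first by [].
by rewrite !iterS; apply: run_round.
Qed.

End Correctness.

(** * Correctness of the greedy algorithm *)

Section GreedyCorrect.
Variables (T : finType) (e : rel T).
Hypothesis e_sym : symmetric e.
Hypothesis T_inhabited : 0 < #|T|.
Implicit Types (S Q R : {set T}).

Lemma root_in S : S != set0 -> exists2 r, r \in S & root S = [set r].
Proof.
case/set0Pn => x xS; rewrite /root.
suffices gen l Q : (exists2 r, r \in S & Q = [set r]) \/ has (mem S) l ->
    exists2 r, r \in S & foldl (fun Q x => if x \in S then [set x] else Q) Q l = [set r].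
  by apply: gen; right; apply/hasP; exists x; rewrite ?mem_enum.
elim: l Q => [|y l IH] Q; first by case.
rewrite /= => H; apply: IH; move: H; case: ifP => yS; last by case; [left|right].
by left; exists y.
Qed.

Lemma root_set0 : root (set0 : {set T}) = set0.
Proof. by rewrite /root; elim: (enum T) => //= x l; rewrite inE. Qed.

(** Reached vertices of [S] are joined to the root inside [S], other reached vertices have a
    neighbour in [S]. From an empty [S] nothing is reached, while [T] is inhabited. *)
Lemma spans_cds S : spans e S -> cds e S.
Proof.
have [->|S0] := eqVneq S set0.
  rewrite /spans root_set0.
  have -> : iter #|T| (grow e set0) set0 = set0.
    elim: #|T| => //= n ->; apply/setP => x; rewrite !inE.
    by apply/exists_inP => -[u]; rewrite !inE.
  by move/eqP/setP => /= full; case/card_gt0P: T_inhabited => x _; have := full x; rewrite !inE.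
have [r rS rootE] := root_in S0; rewrite /spans rootE => /eqP full.
have inv n x : x \in iter n (grow e S) [set r] ->
    if x \in S then connect (induced e S) x r else [exists u in S, e x u].
  elim: n x => [|n IH] x /=; first by move/set1P->; rewrite rS connect0.
  case/setUP => [/IH//|]; rewrite inE => /exists_inP[u /setIP[/IH + uS] exu].
  rewrite uS; case: ifP => [xS|_ _]; last by apply/exists_inP; exists u.
  by apply: connect_trans; apply: connect1; apply/and3P.
split=> //.
- apply: (connected_on_hub e_sym (c := r)) => x xS.
  by have := inv #|T| x; rewrite full inE xS => /(_ isT).
- move=> x /negPf xS; have := inv #|T| x; rewrite full inE xS => /(_ isT).
  by case/exists_inP=> u; exists u.
Qed.

(** Until the closure is complete, each round adds a vertex, so [#|T|] rounds suffice: a stable set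
    containing the root contains [S] by connectivity, then everything by domination. *)
Lemma cds_spans S : cds e S -> spans e S.
Proof.
move=> [S0 conS domS]; have [r rS rootE] := root_in S0; rewrite /spans rootE.
have sub_grow Q : Q \subset grow e S Q by apply: subsetUl.
have fix_full Q : r \in Q -> grow e S Q = Q -> Q = [set: T].
  move=> rQ fixQ.
  have clQ u w : u \in Q -> u \in S -> e w u -> w \in Q.
    by move=> uQ uS ewu; rewrite -fixQ !inE; apply/orP; right;
      apply/exists_inP; exists u; rewrite ?inE ?uQ.
  have /subsetP SQ : S \subset Q.
    apply: (connected_on_closed conS rS rQ) => u w uS _ uQ; rewrite e_sym.
    exact: clQ.
  apply/setP => x; rewrite inE; have [/SQ//|/domS[u uS exu]] := boolP (x \in S).
  by apply: clQ exu => //; apply: SQ.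
have inv n : let Q := iter n (grow e S) [set r] in r \in Q /\ (Q = [set: T] \/ n < #|Q|).
  elim: n => [|n [rQ grown]] /=; first by rewrite set11 cards1; split; last right.
  set Q := iter n _ _ in rQ grown *; split; first exact: (subsetP (sub_grow Q)).
  case: grown => [->|lt_n]; first by left; apply/setP => x; rewrite !inE.
  have [fixQ|neq] := eqVneq (grow e S Q) Q; first by left; rewrite fixQ; apply: fix_full.
  right; apply: leq_ltn_trans lt_n _; apply: proper_card.
  by rewrite properEneq eq_sym neq sub_grow.
by apply/eqP; have [_ [//|]] := inv #|T|; rewrite ltnNge max_card.
Qed.

(** A vertex kept at its test stays indispensable: if the final set without it were a CDS, so would
    be the larger set rejected at the test. *)
Lemma minimize_minimal R :
  cds e R -> minimal_cds e (minimize e R) /\ minimize e R \subset R.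
Proof.
move=> cdsR; rewrite /minimize.
suffices gen l S : cds e S ->
    [/\ foldl (thin e) S l \subset S, cds e (foldl (thin e) S l) &
        forall v, v \in l -> v \in foldl (thin e) S l -> ~ cds e (foldl (thin e) S l :\ v)].
  have [sub cdsS minS] := gen (enum T) R cdsR; split=> //; split=> // v.
  by apply: minS; rewrite mem_enum.
elim: l S => [|x l IH] S cdsS //=.
have thin_sub : thin e S x \subset S by rewrite /thin; case: ifP => // _; apply: subD1set.
have cds_thin : cds e (thin e S x) by rewrite /thin; case: ifP => // /spans_cds.
have [sub cdsF minF] := IH _ cds_thin; split=> //; first exact: subset_trans thin_sub.
move=> v; rewrite inE => /orP[/eqP->|]; last exact: minF.
move=> xF cds_x; have := subsetP sub x xF.
have [span|/negP[]] := boolP (spans e (S :\ x)); first by rewrite /thin span !inE eqxx.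
by apply/cds_spans/(cds_superset e_sym cds_x)/setSD/(subset_trans sub).
Qed.

End GreedyCorrect.

(** Counting memberships also excludes repetitions in [L]: parts are nonempty, and a repeated one
    would count its elements twice. *)
Lemma cds_partition_count (T : finType) (e : rel T) (L : seq {set T}) :
    {in L, forall S, cds e S} ->
    (forall x, count (fun S : {set T} => x \in S) L = 1) ->
  cds_partition e (size L) [set:: L].
Proof.
move=> cdsL count1.
have ex_in S : S \in L -> exists x, x \in S by case/cdsL => /set0Pn.
have same (X Y : {set T}) x : X \in L -> Y \in L -> x \in X -> x \in Y -> X = Y.
  move=> XL YL xX xY; have := count1 x; rewrite -size_filter.
  have : X \in [seq S : {set T} <- L | x \in S] by rewrite mem_filter xX.
  have : Y \in [seq S : {set T} <- L | x \in S] by rewrite mem_filter xY.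
  by case: filter => [|Z []] //; rewrite !inE => /eqP-> /eqP->.
have uniqL : uniq L.
  apply: count_mem_uniq => S; have [SL|/count_memPn//] := boolP (S \in L).
  apply/eqP; rewrite eqn_leq -has_count has_pred1 SL andbT /=.
  have [x xS] := ex_in S SL; rewrite -(count1 x); apply: sub_count => Y /eqP->.
  exact: xS.
split; last by move=> S; rewrite inE => /cdsL.
- apply/and3P; split.
  + apply/eqP/setP => x; rewrite inE; apply/bigcupP.
    have : has (fun S : {set T} => x \in S) L by rewrite has_count count1.
    by case/hasP=> S SL xS; exists S; rewrite ?inE.
  + apply/trivIsetP => X Y; rewrite !inE => XL YL; apply: contraNT.
    by case/pred0Pn=> x /andP[xX xY]; apply/eqP; apply: same XL YL xX xY.
  + by rewrite inE; apply/negP => /ex_in[x]; rewrite inE.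
- by rewrite -(card_uniqP uniqL); apply: eq_card => S; rewrite inE.
Qed.

Lemma greedy_partition (k : nat) (T : finType) (e : rel T) :
    1 <= k -> simple_graph e -> t_connected e (4 * k) -> convex_bipartite e ->
  cds_partition e k [set:: (greedy e k).1 :: (greedy e k).2] /\ size (greedy e k).2 = k.-1.
Proof.
move=> k1 [e_sym e_irr] conn [A [B [sigma [bip uniq_s sigmaA convex]]]].
have T0 : 0 < #|T| by case: conn => lt _; apply: leq_ltn_trans lt.
pose covers (st : {set T} * seq {set T}) :=
  forall x, (x \in st.1) + count (fun S : {set T} => x \in S) st.2 = 1.
(* By [covers], [R] is the remainder of [L]. Fewer than [k] removed sets give [4 * size L < 4 * k],
   both before each round and at the end. *)
have cds_rest R L : covers (R, L) -> size L < k -> {in L, forall S, minimal_cds e S} -> cds e R.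
  move=> cov Lk minL; suffices -> : R = remainder L.
    apply: (remainder_cds e_sym e_irr bip uniq_s sigmaA convex conn) => //; lia.
  apply/setP => x; have := cov x; rewrite inE /=.
  have -> : all (fun S : {set T} => x \notin S) L = ~~ (0 < count (fun S : {set T} => x \in S) L).
    by rewrite -has_count -all_predC.
  by case: (x \in R); case: (count _ L).
have inv m : m <= k.-1 -> let st := iter m (round e) ([set: T], [::]) in
    [/\ size st.2 = m, covers st & {in st.2, forall S, minimal_cds e S}].
  elim: m => [|m IH] lt_m.
    by split=> // x; rewrite /= inE.
  rewrite iterS; case: (iter m _ _) (IH (ltnW lt_m)) => R L /= [sz cov minL].
  have [|minS sub] := @minimize_minimal _ _ e_sym T0 R.
    by apply: (cds_rest R L) => //; rewrite sz; lia.
  split; first by rewrite sz.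
    move=> x /=; rewrite inE -(cov x) /= addnA; congr (_ + _).
    by have := subsetP sub x; case: (x \in minimize e R); case: (x \in R) => // /(_ isT).
  by move=> S; rewrite inE => /orP[/eqP->|/minL].
have [sz cov minL] := inv k.-1 (leqnn _); split=> //.
rewrite -[k](prednK k1); rewrite -[X in cds_partition _ X.+1]sz.
apply: (@cds_partition_count _ _ (_ :: _)) => [S|x]; last exact: (cov x).
rewrite inE => /orP[/eqP->|/minL[]//].
rewrite /greedy; case: (iter _ _ _) sz cov minL => R L /= sz cov minL.
by apply: (cds_rest R L) => //; rewrite sz; lia.
Qed.

Lemma runs_main (k : nat) (T : finType) (e : rel T) n :
    n = tree_size (enc_instance e k) ->
  exists2 t, runs p_main (enc_instance e k)
               (enc_seq (@enc_set T) ((greedy e k).1 :: (greedy e k).2)) t &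
             t <= time_bound p_greedy n + 5.
Proof.
move=> ->; set s := update (fun=> Leaf) 0 (enc_instance e k).
have [t ex le_t] := @compile_exec p_greedy s (tree_size (enc_instance e k)) isT (leqnn _).
(* The final assignment costs 4, its [CSeq] one more; the pair it builds is the encoded list with
   the remaining set in front. *)
exists (t + 4).+1; last by rewrite -addnS leq_add2r.
exists (update (run p_greedy s) 0 (eval (run p_greedy s) (ENode (EVar vR) (EVar vOut)))).
  by apply: exec_seq ex _; apply: (exec_assign _ 0 (ENode (EVar vR) (EVar vOut))).
have [sR sOut] := @run_greedy _ e k s erefl.
by rewrite /update /= sR sOut.
Qed.

Theorem theorem10 :
  (forall (k : nat) (T : finType) (e : rel T),
     1 <= k -> simple_graph e -> t_connected e (4 * k) -> convex_bipartite e ->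
     exists P : {set {set T}}, cds_partition e k P)
  /\
  (exists (p : cmd) (c d : nat),
     forall (k : nat) (T : finType) (e : rel T),
     1 <= k -> simple_graph e -> t_connected e (4 * k) -> convex_bipartite e ->
     exists (L : seq {set T}) (t : nat),
       [/\ cds_partition e k [set:: L], size L = k,
           runs p (enc_instance e k) (enc_seq (@enc_set T) L) t &
           t <= c * tree_size (enc_instance e k) ^ d]).
Proof.
split=> [k T e k1 simple conn convex|].
  by have [part _] := greedy_partition k1 simple conn convex; eexists; exact: part.
have [c [d bound]] := time_bound_polynomial p_greedy.
exists p_main, (c + 5), d => k T e k1 simple conn convex.
have [part sz] := greedy_partition k1 simple conn convex.
have [t run_t le_t] := @runs_main k T e _ erefl.
exists ((greedy e k).1 :: (greedy e k).2), t; split=> //; first by rewrite /= sz prednK.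
apply: leq_trans le_t _; rewrite mulnDl.
have pos_n : 0 < tree_size (enc_instance e k) by [].
by apply: leq_add; [apply: bound | rewrite -{1}(muln1 5) leq_mul2l expn_gt0 pos_n].
Qed.
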